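(* For integers $N\ge 1$ and $n\ge 1$, $$c_{N,n}=(-1)^n n!\sum_{k=1}^n\binom{n+1}{k+1}\frac{(-N)^k\,k!}{(n+Nk)!}\begin{bmatrix}n+Nk\\ k\end{bmatrix}_{\ge N}.$$
   Context: The hypergeometric Cauchy numbers $c_{N,n}$ are defined by $\frac{1}{{}_2F_1(1,N;N+1;-x)}=\sum_{n=0}^\infty c_{N,n}\frac{x^n}{n!}$, where ${}_2F_1(a,b;c;z)=\sum_{n=0}^\infty\frac{(a)^{(n)}(b)^{(n)}}{(c)^{(n)}}\frac{z^n}{n!}$ with $(a)^{(n)}=a(a+1)\cdots(a+n-1)$, $(a)^{(0)}=1$. For $m\ge1$, the associated Stirling numbers of the first kind $\begin{bmatrix}n\\ k\end{bmatrix}_{\ge m}$ are defined by $\frac{(-\log(1-x)-F_{m-1}(x))^k}{k!}=\sum_{n=0}^\infty\begin{bmatrix}n\\ k\end{bmatrix}_{\ge m}\frac{x^n}{n!}$, where $F_0(x)=0$ and $F_m(x)=\sum_{j=1}^m\frac{x^j}{j}$ for $m\ge1$. *)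

(* Defs.v *)
From mathcomp Require Import all_boot all_order all_algebra.

Set Implicit Arguments.
Unset Strict Implicit.
Unset Printing Implicit Defensive.

Import GRing.Theory.
Local Open Scope ring_scope.

(* Generating functions are formal power series over the rationals;           *)
(* f : fps stands for \sum_(n >= 0) f n * x^n.                                *)
Definition fps := nat -> rat.

Definition fps_one : fps := fun n => (n == 0)%:R.

Definition fps_sub (f g : fps) : fps := fun n => f n - g n.

Definition fps_opp (f : fps) : fps := fun n => - f n.

Definition fps_mul (f g : fps) : fps :=
  fun n => \sum_(i < n.+1) f i * g (n - i)%N.

Definition fps_exp (f : fps) (k : nat) : fps := iter k (fps_mul f) fps_one.

(* f(- x) *)
Definition fps_compN (f : fps) : fps := fun n => (- 1) ^+ n * f n.

Definition fps_poly (p : {poly rat}) : fps := fun n => p`_n.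

(* The first n + 1 coefficients of 1 / f, when f 0 != 0.                      *)
Fixpoint fps_inv_seq (f : fps) (n : nat) : seq rat :=
  if n is m.+1 then
    let s := fps_inv_seq f m in
    rcons s (- (f 0%N)^-1 * \sum_(i < m.+1) f (m.+1 - i)%N * s`_i)
  else [:: (f 0%N)^-1].

Definition fps_inv (f : fps) : fps := fun n => (fps_inv_seq f n)`_n.

Lemma size_fps_inv_seq f n : size (fps_inv_seq f n) = n.+1.
Proof. by elim: n => //= n IHn; rewrite size_rcons IHn. Qed.

Lemma nth_fps_inv_seq f n i : (i <= n)%N -> (fps_inv_seq f n)`_i = fps_inv f i.
Proof.
elim: n => [|n IHn]; first by rewrite leqn0 => /eqP->.
rewrite leq_eqVlt => /orP[/eqP-> // | lt_in].
by rewrite /= nth_rcons size_fps_inv_seq lt_in IHn.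
Qed.

Lemma fps_mulV (f : fps) : f 0%N != 0 -> fps_mul (fps_inv f) f =1 fps_one.
Proof.
move=> f0 [|n]; first by rewrite /fps_mul big_ord1 mulVf.
rewrite /fps_mul big_ord_recr /= subnn {2}/fps_inv /=.
rewrite nth_rcons size_fps_inv_seq ltnn eqxx mulNr mulNr mulrAC mulVf // mul1r.
apply/eqP; rewrite subr_eq0; apply/eqP; apply: eq_bigr => i _.
by rewrite nth_fps_inv_seq 1?mulrC // -ltnS.
Qed.

(* The a_n such that f(x) = \sum_n a_n x^n / n!.                              *)
Definition egf_coef (f : fps) (n : nat) : rat := n`!%:R * f n.

Definition rising (a : rat) (n : nat) : rat := \prod_(i < n) (a + i%:R).

(* 2F1(a, b; c; z) as a series in z *)
Definition hyp2F1 (a b c : rat) : fps :=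
  fun n => rising a n * rising b n / rising c n / n`!%:R.

Definition hcauchy (N n : nat) : rat :=
  egf_coef (fps_inv (fps_compN (hyp2F1 1 N%:R N.+1%:R))) n.

(* log(1 - x) = - \sum_(n >= 1) x^n / n; the constant term is 0 since         *)
(* 0^-1 = 0 in rat.                                                           *)
Definition log1m : fps := fun n => - n%:R^-1.

Definition logF (m : nat) : {poly rat} := \sum_(1 <= j < m.+1) j%:R^-1 *: 'X^j.

(* Associated Stirling numbers of the first kind [n, k]_(>= m), for m >= 1    *)
Definition astirling1 (m n k : nat) : rat :=
  egf_coef
    (fun i =>
       fps_exp (fps_sub (fps_opp log1m) (fps_poly (logF m.-1))) k i / k`!%:R)
    n.

(* Main.v *)
Require Import Defs.
From mathcomp Require Import all_boot all_order all_algebra.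
From mathcomp Require Import ring.

Set Implicit Arguments.
Unset Strict Implicit.
Unset Printing Implicit Defensive.

Import GRing.Theory.
Local Open Scope ring_scope.

(** Put h = 2F1(1, N; N+1; x) = \sum_n N/(N+n) x^n.  Then
    - log(1 - x) - F_(N-1)(x) = x^N h / N, so the k-th summand is
    'C(n+1, k+1) (-1)^k [x^n] h^k.  Since h(0) = 1, the series (1 - h)^(n+1)
    has order at least n+1, hence [x^n] 1/h = [x^n] (1 - (1 - h)^(n+1)) / h, and
    the binomial theorem gives the claim.  Identities between power series are
    proved on their polynomial truncations. *)

(** A coefficient of a product depends only on coefficients of at most the same index, so truncation
    is harmless and the ring theory of [{poly rat}] applies to series. *)
Lemma coef_exp_trunc (f : fps) m k i : (i < m)%N ->
  ((\poly_(j < m) f j) ^+ k)`_i = fps_exp f k i.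
Proof.
elim: k i => [|k IHk] i lt_im; first by rewrite expr0 coef1.
rewrite exprS coefM; apply: eq_bigr => j _.
have le_ji : (j <= i)%N by rewrite -ltnS.
rewrite coef_poly (leq_ltn_trans le_ji lt_im) IHk //.
exact: leq_ltn_trans (leq_subr _ _) lt_im.
Qed.

Lemma fps_exp_compN f k : fps_exp (fps_compN f) k =1 fps_compN (fps_exp f k).
Proof.
elim: k => [|k IHk] n.
  by rewrite /fps_compN /= /fps_one; case: n => [|n]; rewrite ?mulr0 ?mulr1.
rewrite /fps_compN /= /fps_mul mulr_sumr; apply: eq_bigr => i _.
rewrite [X in _ * X]IHk /fps_compN.
have le_in : (i <= n)%N by rewrite -ltnS.
by rewrite mulrACA -exprD subnKC.
Qed.

(** The hypotheses say [f = c x^N g], whence [f^k = c^k x^(N k) g^k]. *)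
Lemma fps_exp_shift (f g : fps) (c : rat) N n k :
    (forall i, (i < N)%N -> f i = 0) -> (forall i, f (i + N)%N = c * g i) ->
  fps_exp f k (n + N * k) = c ^+ k * fps_exp g k n.
Proof.
move=> f_lt f_ge; set m := (n + N * k).+1.
(* Truncating [f] at [m + N] and [g] at [m] makes this an exact identity of polynomials. *)
have fE : \poly_(i < m + N) f i = 'X^N * (c *: \poly_(i < m) g i).
  apply/polyP=> i; rewrite coefXnM coefZ !coef_poly.
  case: (ltnP i N) => [lt_iN | leNi]; first by rewrite f_lt // if_same.
  rewrite -(subnK leNi) addnK ltn_add2r f_ge.
  by case: ifP; rewrite ?mulr0.
rewrite -(@coef_exp_trunc f (m + N)) ?ltn_addr // fE exprMn exprZn -exprM.
rewrite coefXnM ltnNge leq_addl /= addnK coefZ coef_exp_trunc //.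
by rewrite ltnS leq_addr.
Qed.

Lemma coef_fps_inv (f : fps) n : f 0%N = 1 ->
  fps_inv f n = \sum_(k < n.+1) 'C(n.+1, k.+1)%:R * (- 1) ^+ k * fps_exp f k n.
Proof.
move=> f0; pose P := \poly_(i < n.+1) f i.
pose Q := \poly_(i < n.+1) fps_inv f i.
have QP i : (i < n.+1)%N -> (Q * P)`_i = (i == 0%N)%:R.
  move=> lt_in; rewrite -[RHS](@fps_mulV f) ?f0 ?oner_eq0 // coefM.
  apply: eq_bigr => j _; have le_ji : (j <= i)%N by rewrite -ltnS.
  rewrite !coef_poly (leq_ltn_trans le_ji lt_in).
  by rewrite (leq_ltn_trans (leq_subr _ _) lt_in).
(* Hence [(1 - P) ^+ n.+1] is a multiple of ['X^n.+1] and vanishes in degree [n]. *)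
have [R PE] : exists R, 1 - P = R * 'X.
  have /factor_theorem[R ER] : root (1 - P) 0.
    by rewrite /root horner_coef0 coefB coef1 coef_poly f0 subrr.
  by exists R; rewrite ER subr0.
(* The leading 1 cancels the constant binomial term; factoring [P] out of the rest shifts the index,
   hence [k.+1] in the binomial. *)
have binomP : 1 - (1 - P) ^+ n.+1 =
    P * \sum_(k < n.+1) ('C(n.+1, k.+1)%:R * (- 1) ^+ k) *: P ^+ k.
  rewrite exprBn big_ord_recl expr0 expr1n bin0 mulr1n !mulr1.
  rewrite opprD addNKr mulr_sumr -sumrN; apply: eq_bigr => k _.
  rewrite /= expr1n mulr1 /bump leq0n add1n -scalerAr -exprS.
  rewrite -mul_polyC polyCM polyC_exp polyCN polyC_natr -mulr_natl (exprS (-1)).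
  by ring.
(* On the left only [Q] contributes in degree [n]; on the right [Q * P] acts as 1 up to that
   degree. *)
have := congr1 (fun p => (Q * p)`_n) binomP.
rewrite mulrBr mulr1 coefB PE exprMn !mulrA coefMXn ltnSn subr0 coef_poly ltnSn.
move->; rewrite coefM big_ord_recl QP // mul1r subn0 [X in _ + X]big1 ?addr0.
  rewrite coef_sum; apply: eq_bigr => k _.
  by rewrite coefZ coef_exp_trunc.
by move=> j _; rewrite QP ?mul0r // ltn_ord.
Qed.

Lemma natr_fact_neq0 k : k`!%:R != 0 :> rat.
Proof. by rewrite Num.Theory.pnatr_eq0 -lt0n fact_gt0. Qed.

Lemma risingSr a n : rising a n.+1 = rising a n * (a + n%:R).
Proof. by rewrite /rising big_ord_recr. Qed.

Lemma rising_nat m n : rising m.+1%:R n = (m + n)`!%:R / m`!%:R.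
Proof.
elim: n => [|n IHn].
  by rewrite /rising big_ord0 addn0 divff ?natr_fact_neq0.
rewrite risingSr IHn -natrD addSn addnS factS natrM.
by rewrite mulrAC [X in X / _ = _]mulrC.
Qed.

(** The factor [rising 1 n] is [n!], and the quotient of the other two telescopes. *)
Lemma hyp2F1_1NE N n : (0 < N)%N ->
  hyp2F1 1 N%:R N.+1%:R n = N%:R / (N + n)%:R.
Proof.
case: N => // N _; rewrite /hyp2F1 (rising_nat 0) !rising_nat add0n divr1.
have nat0 k : k.+1%:R != 0 :> rat by rewrite Num.Theory.pnatr_eq0.
rewrite addSn !factS !natrM.
by field; rewrite !natr_fact_neq0 -natrD !nat1r !nat0.
Qed.

Lemma coef_log_tail N i : (0 < N)%N ->
  fps_sub (fps_opp log1m) (fps_poly (logF N.-1)) i =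
    if (i < N)%N then 0 else i%:R^-1.
Proof.
case: N => // N _; rewrite /fps_sub /fps_opp /log1m opprK /fps_poly.
rewrite /logF coef_sum.
under eq_bigr => j _ do rewrite coefZ coefXn.
(* Index 0 is separate: it relies on [0^-1 = 0], and [logF] has no constant term. *)
case: i => [|i].
  by rewrite invr0 sub0r big1_seq ?oppr0 // => -[|j];
    rewrite ?mem_index_iota //= mulr0.
rewrite /= (eq_bigr (fun j => if j == i.+1 then i.+1%:R^-1 else 0)); last first.
  by move=> j _; rewrite eq_sym; case: eqP => [->|]; rewrite ?mulr1 ?mulr0.
rewrite -big_mkcond big_nat1_eq /=.
by case: ltnP; rewrite ?subrr ?subr0.
Qed.

Theorem theorem4 (N n : nat) (hN : (1 <= N)%N) (hn : (1 <= n)%N) :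
  hcauchy N n =
    (- 1) ^+ n * n`!%:R *
    \sum_(1 <= k < n.+1)
       'C(n.+1, k.+1)%:R * ((- N%:R) ^+ k * k`!%:R / (n + N * k)`!%:R) *
       astirling1 N (n + N * k) k.
Proof.
have N0 : N%:R != 0 :> rat by rewrite Num.Theory.pnatr_eq0 -lt0n.
set h := hyp2F1 1 N%:R N.+1%:R.
have h0 : fps_compN h 0%N = 1.
  by rewrite /fps_compN mul1r /h hyp2F1_1NE // addn0 divff.
rewrite /hcauchy /egf_coef coef_fps_inv // -mulrA mulrCA; congr (_ * _).
(* The term [k = 0] is the coefficient of [x^n] in 1, which is 0 because [n] is positive. *)
rewrite big_ord_recl [fps_exp _ _ _]/= /fps_one eqn0Ngt hn mulr0 add0r.
rewrite big_add1 big_mkord mulr_sumr; apply: eq_bigr => k _.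
(* The constant comes from [1/(i + N) = (1/N) (N/(N + i))]; its power cancels that of [N] in the
   summand. *)
rewrite /astirling1 /egf_coef (@fps_exp_shift _ h N%:R^-1); last 2 first.
- by move=> i lt_iN; rewrite coef_log_tail // lt_iN.
- move=> i; rewrite coef_log_tail // ltnNge leq_addl.
  by rewrite /h hyp2F1_1NE // mulKf // addnC.
rewrite lift0 fps_exp_compN /fps_compN [(- N%:R) ^+ _]exprNn exprVn.
have := natr_fact_neq0 (n + N * k.+1)%N; have := natr_fact_neq0 k.+1.
have : N%:R ^+ k.+1 != 0 :> rat by rewrite expf_neq0.
move: (N%:R ^+ _) (_`!%:R) (_`!%:R) => a b c a0 b0 c0.
by field; rewrite a0 b0 c0.
Qed.
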